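(* In the Best-2 case of the Sliding-Window Secretary Problem, for large $N$ the largest window size for which the optimal second threshold satisfies $d_2^*>1$ is $K=\frac{N-1}{\sqrt2}$ asymptotically. That is, if $K_{\max}(N)$ denotes the largest integer $K$ with $1\le K<N$ such that $d_2^*>1$ for $N$ applicants and window size $K$, then $$\lim_{N\to\infty}\frac{K_{\max}(N)}{(N-1)/\sqrt2}=1.$$
   Context: Setting (Best-2 case with window size $K$). There are $N$ applicants, seen in the order of their indices $1,\dots,N$. $R$ is a uniformly random permutation of $\{1,\dots,N\}$; $R(m)$ is the absolute rank of the applicant at index $m$, with $1$ the best rank. The interviewer observes only relative ranks of the applicants seen so far. When the window starts at index $i$, it consists of applicants $i,\dots,\min(i+K-1,N)$, and exactly the applicants $1,\dots,\min(i+K-1,N)$ have been seen. The interviewer may then choose any applicant in the window (ending the process) or reject applicant $i$ and move the window to start at $i+1$; rejected applicants cannot be recalled. One applicant can be chosen, and the interviewer wins iff the chosen applicant has rank $1$ or $2$. Under the sliding rule (reject applicants until the best candidate in the window is at the window's first index), applicant $i$ is a 2-candidate iff, when the window starts at $i$, applicant $i$ is the second best of applicants $1,\dots,\min(i+K-1,N)$ and the best of these has index less than $i$. Optimal second threshold: $d_2^*+1$ is the smallest index $i\ge 2$ (a 2-candidate cannot occur at index 1) such that, conditionally on the window starting at $i$ and applicant $i$ being a 2-candidate, choosing applicant $i$ gives a strictly larger probability of winning than rejecting applicant $i$ and continuing optimally. *)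

(* Defs.v *)
From HB Require Import structures.
From mathcomp Require Import all_boot all_order all_algebra all_fingroup.

Set Implicit Arguments.
Unset Strict Implicit.
Unset Printing Implicit Defensive.
Import Order.TTheory GRing.Theory Num.Theory.

Local Open Scope ring_scope.

(* Applicants are the elements of 'I_N.  Indices and ranks are 1-based, so the
   applicant [a] has index [a.+1], and absolute rank [(s a).+1] under the
   permutation [s]. *)
Definition pos (N : nat) (a : 'I_N) : nat := a.+1.

Definition abs_rank (N : nat) (s : 'S_N) (a : 'I_N) : nat := (s a).+1.

(* Meaningful when [pos a <= n]. *)
Definition rel_rank (N : nat) (s : 'S_N) (n : nat) (a : 'I_N) : nat :=
  #|[set b : 'I_N | (pos b <= n)%N && (abs_rank s b <= abs_rank s a)%N]|.

(* A window position is identified with the applicant [a] at its first index. *)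
Definition seen (N K : nat) (a : 'I_N) : nat := (minn (pos a + K - 1) N)%N.

Definition in_window (N K : nat) (a b : 'I_N) : bool :=
  (pos a <= pos b <= seen K a)%N.

(* Entry [b] is the relative rank of [b] among the applicants seen so far, or 0
   if [b] has not been seen. *)
Definition observations (N : nat) : finType := {ffun 'I_N -> 'I_N.+1}.

Definition observe (N K : nat) (s : 'S_N) (a : 'I_N) : observations N :=
  [ffun b : 'I_N =>
     if (pos b <= seen K a)%N then inord (rel_rank s (seen K a) b) else ord0].

(* Given the window position and the observations, [Some b] chooses [b] and
   [None] rejects the first applicant of the window. *)
Definition policy (N : nat) : finType :=
  {ffun 'I_N * observations N -> option 'I_N}.

Definition admissible (N K : nat) (p : policy N) : bool :=
  [forall a, forall o, if p (a, o) is Some b then in_window K a b else true].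

(* The applicant chosen by [p] when the window runs through the positions [w];
   [None] if every applicant is rejected. *)
Fixpoint play (N K : nat) (p : policy N) (s : 'S_N) (w : seq 'I_N) :
    option 'I_N :=
  if w is a :: w' then
    if p (a, observe K s a) is Some b then Some b else play K p s w'
  else None.

Definition play_after (N K : nat) (p : policy N) (s : 'S_N) (a : 'I_N) :
    option 'I_N :=
  play K p s [seq b <- enum 'I_N | (pos a < pos b)%N].

Definition win (N : nat) (s : 'S_N) (c : option 'I_N) : bool :=
  if c is Some b then (abs_rank s b <= 2)%N else false.

Definition prob (N : nat) (A : {set 'S_N}) : rat :=
  #|A|%:R / #|[set: 'S_N]|%:R.

Definition cond_prob (N : nat) (A B : {set 'S_N}) : rat :=
  prob (A :&: B) / prob B.

Definition two_candidate (N K : nat) (s : 'S_N) (a : 'I_N) : bool :=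
  (rel_rank s (seen K a) a == 2)%N &&
  [exists b : 'I_N, (pos b < pos a)%N && (rel_rank s (seen K a) b == 1)%N].

Definition two_candidate_event (N K : nat) (a : 'I_N) : {set 'S_N} :=
  [set s | two_candidate K s a].

(* That the window starts at [a] is not an event here: the process is put in
   that position.  It only means that the applicants before [a] were rejected,
   decisions which are functions of what has been observed. *)
Definition choose_value (N K : nat) (a : 'I_N) : rat :=
  cond_prob [set s | win s (Some a)] (two_candidate_event K a).

(* Probabilities are nonnegative, so the default 0 of the maximum is harmless. *)
Definition reject_value (N K : nat) (a : 'I_N) : rat :=
  \big[Num.max/0]_(p : policy N | admissible K p)
    cond_prob [set s | win s (play_after K p s a)] (two_candidate_event K a).

(* For 1 <= K < N the filtered list is nonempty: it contains the index N, where
   choosing a 2-candidate wins for sure and rejecting it loses. *)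
Definition d2_star (N K : nat) : nat :=
  (head 0%N [seq pos a | a <- enum 'I_N &
            (2 <= pos a)%N && (reject_value K a < choose_value K a)]).-1.

(* The default 0 is outside the range of K, so a nonzero limit of the ratio
   K_max N / ((N - 1) / sqrt 2) entails that such a K exists for large N. *)
Definition K_max (N : nat) : nat :=
  (\max_(K < N | (1 <= K) && (1 < d2_star N K)) K)%N.

(* Main.v *)
(* Put n = K + 1 and consider the window starting at index 2, where applicant 2
   is second best and applicant 1 best of the first n.  Choosing applicant 2
   wins iff 1 and 2 are the two best overall, which has conditional probability
   q = n (n - 1) / (N (N - 1)).  Rejecting it can only win when they are not,
   hence with probability at most 1 - q; and when N <= 2 K + 1 every applicant
   arriving after the first n is still in the window once all N have been seen,
   so waiting until then achieves 1 - q.  Hence d_2^* > 1 forces q <= 1/2, with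
   equivalence when N <= 2 K + 1, and for N >= 4
   K_max is the largest K with 2 K (K + 1) <= N (N - 1). *)


Require Import Defs.
From mathcomp Require Import all_boot all_order all_algebra all_fingroup.
From mathcomp Require Import all_classical all_reals all_analysis.
From mathcomp Require Import zify lra.

Set Implicit Arguments.
Unset Strict Implicit.
Unset Printing Implicit Defensive.
Import Order.TTheory GRing.Theory Num.Theory.
Import numFieldNormedType.Exports.

Local Open Scope ring_scope.

(** * The two best of the first [n] applicants, and relative ranks *)

(** Phrased by comparing values of [s], so that permuting applicants acts on it directly;
    [rel_rank2P] translates it into relative ranks 1 and 2. *)
Definition best_two (N n : nat) (i j : 'I_N) (s : 'S_N) : bool :=
  (s i < s j)%N &&
  [forall c : 'I_N, [&& (c < n)%N, c != i & c != j] ==> (s j < s c)%N].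

Definition best_two_set (N n : nat) (i j : 'I_N) : {set 'S_N} :=
  [set s | best_two n i j s].

Lemma card_ord_ltn N n : (n <= N)%N -> #|[set x : 'I_N | (x < n)%N]| = n.
Proof. by move=> nN; rewrite -sum1dep_card (big_ord_narrow nN) sum1_card card_ord. Qed.

Lemma rel_rank_full N (s : 'S_N) (a : 'I_N) : rel_rank s N a = (s a).+1.
Proof.
rewrite /rel_rank.
have -> : [set b : 'I_N | (pos b <= N)%N && (abs_rank s b <= abs_rank s a)%N]
          = [set b | s b \in [set x : 'I_N | (x < (s a).+1)%N]].
  by apply/setP => b; rewrite !inE /pos /abs_rank ltn_ord /= ltnS.
rewrite -[[set b | _]]/(s @^-1: _)%SET on_card_preimset; last first.
  by exists (s^-1)%g => x _; rewrite ?permK ?permKV.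
by rewrite card_ord_ltn.
Qed.

Lemma rel_rank_self N (s : 'S_N) n (a : 'I_N) : (pos a <= n)%N ->
  a \in [set b : 'I_N | (pos b <= n)%N && (abs_rank s b <= abs_rank s a)%N].
Proof. by move=> an; rewrite inE an leqnn. Qed.

(** The counted set always contains [a], so it has one element iff it is the singleton of [a]. *)
Lemma rel_rank1P N (s : 'S_N) n (a : 'I_N) : (pos a <= n)%N ->
  reflect (forall c : 'I_N, (c < n)%N -> c != a -> (s a < s c)%N)
          (rel_rank s n a == 1)%N.
Proof.
move=> an; apply: (iffP idP) => [/cards1P[x xE] c cn ca | H].
  have := rel_rank_self s an; rewrite xE inE => /eqP ax; subst x.
  rewrite ltnNge; apply: contra ca => sca.
  by rewrite -finset.in_set1 -xE inE /pos cn.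
apply/cards1P; exists a; apply/setP => c; rewrite !inE /pos /abs_rank ltnS.
apply/idP/eqP => [/andP[cn sca]|->]; last by rewrite leqnn andbT.
apply/eqP; apply: contraLR sca => ca; rewrite -ltnNge; exact: H.
Qed.

Lemma rel_rank2P N (s : 'S_N) n (b a : 'I_N) : (pos a <= n)%N -> (pos b <= n)%N ->
  reflect (rel_rank s n b = 1 /\ rel_rank s n a = 2)%N (best_two n b a s).
Proof.
move=> an bn; apply: (iffP idP) => [/andP[sba /forallP H]|[b1 a2]].
  split; first apply/eqP/rel_rank1P => // c cn cb.
    have [->//|ca] := eqVneq c a.
    by apply: (ltn_trans sba); have := H c; rewrite cn cb ca.
  rewrite /rel_rank.
  have -> : [set c : 'I_N | (pos c <= n)%N && (abs_rank s c <= abs_rank s a)%N]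
            = [set a; b].
    apply/setP => c; rewrite !inE /pos /abs_rank ltnS.
    have [->|ca] := eqVneq c a; first by rewrite leqnn andbT.
    have [->|cb] := eqVneq c b; first by rewrite (ltnW sba) andbT.
    apply/negbTE/negP => /andP[cn]; rewrite leqNgt => /negP; apply.
    by have := H c; rewrite cn cb ca.
  by rewrite cards2; case: eqVneq sba => // ->; rewrite ltnn.
have ab : a != b by apply/eqP => ab; move: a2; rewrite ab b1.
have sba : (s b < s a)%N by move/eqP/(rel_rank1P s bn): b1; apply.
rewrite /best_two sba /=; apply/forallP => c; apply/implyP => /and3P[cn cb ca].
rewrite ltnNge; apply/negP => sca.
(* A third applicant [c] better than [a] would join [a] and [b] in the set counted for [a]. *)
suff : (3 <= rel_rank s n a)%N by rewrite a2.
have <- : #|[set a; b; c]| = 3%N.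
  by rewrite finset.setUC cardsU1 !inE negb_or ca cb cards2 ab.
apply/subset_leq_card/fintype.subsetP => x; rewrite !inE /pos /abs_rank ltnS.
by case/orP => [/orP[]|] /eqP ->; rewrite ?leqnn ?andbT ?(ltnW sba) ?sca ?andbT.
Qed.

Lemma best_two_full N (i j : 'I_N) (s : 'S_N) :
  best_two N i j s = (s i == 0 :> nat) && (s j == 1 :> nat).
Proof.
apply/(rel_rank2P s (ltn_ord j) (ltn_ord i))/andP; rewrite !rel_rank_full.
  by case=> [[->] [->]].
by case=> /eqP -> /eqP ->.
Qed.

(** * Counting the permutations with a given best pair *)

(** Since [(g * t) c = t (g c)], left multiplication by [g] is a bijection between the two sets. *)
Lemma card_best_two_perm N n (i j : 'I_N) (g : 'S_N) :
  (forall c, (g c < n)%N = (c < n)%N) ->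
  #|best_two_set n (g i) (g j)| = #|best_two_set n i j|.
Proof.
move=> gn; rewrite -(card_imset (best_two_set n (g i) (g j)) (mulgI g)).
congr #|pred_of_set _|; apply/setP => s.
have key t : best_two n i j (g * t)%g = best_two n (g i) (g j) t.
  rewrite /best_two !permM; congr (_ && _).
  apply/forallP/forallP => H c; last first.
    by have := H (g c); rewrite permM gn !(inj_eq perm_inj).
  rewrite -(permKV g c); have := H (g^-1 c)%g.
  by rewrite permM gn !(inj_eq perm_inj).
rewrite inE; apply/imsetP/idP => [[t]|H]; first by rewrite inE => tE ->; rewrite key.
by exists (g^-1 * s)%g; rewrite ?mulKVg // inE -key mulKVg.
Qed.

Lemma card_best_two_sym N n (i j i' j' : 'I_N) :
  (i < n)%N -> (j < n)%N -> (i' < n)%N -> (j' < n)%N -> i != j -> i' != j' ->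
  #|best_two_set n i j| = #|best_two_set n i' j'|.
Proof.
have tn (x y c : 'I_N) : (x < n)%N -> (y < n)%N -> (tperm x y c < n)%N = (c < n)%N.
  by move=> xn yn; case: tpermP => [->|->|//]; rewrite xn yn.
move=> i_n jn in' jn' ij ij'.
(* Two transpositions carry [(i, j)] to [(i', j')]: the first gives [(i', k)], the second moves [k]
   to [j'] and fixes [i']. *)
pose k := tperm i i' j.
have kn : (k < n)%N by rewrite tn.
have ki' : k != i' by rewrite -[i'](tpermL i) (inj_eq perm_inj) eq_sym.
rewrite -(@card_best_two_perm _ n i j (tperm i i')); last by move=> c; exact: tn.
rewrite tpermL -/k -(@card_best_two_perm _ n i' k (tperm k j')); last first.
  by move=> c; exact: tn.
by rewrite tpermL tpermD // eq_sym.
Qed.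

Lemma best_two_exists N n (s : 'S_N) : (1 < n <= N)%N ->
  exists i j : 'I_N, [/\ (i < n)%N, (j < n)%N & best_two n i j s].
Proof.
case/andP=> n1 nN.
have N1 : (1 < N)%N by apply: leq_trans nN.
pose o0 := Ordinal (ltnW N1); pose o1 := Ordinal N1.
have P0 : [pred c : 'I_N | (c < n)%N] o0 by rewrite /= (ltnW n1).
pose i := [arg min_(c < o0 | (c < n)%N) (s c : nat)].
have [i_n imin] : (i < n)%N /\ forall c : 'I_N, (c < n)%N -> (s i <= s c)%N.
  by rewrite /i; case: arg_minnP.
(* [k] only witnesses that some index below [n] differs from [i]; the second best is the minimiser
   over such indices. *)
pose k := if i == o0 then o1 else o0.
have Pk : ((k < n) && (k != i))%N.
  rewrite /k; case: (eqVneq i o0) => [->|]; first by rewrite /= n1.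
  by rewrite eq_sym (ltnW n1).
case: (@arg_minnP _ k (fun c : 'I_N => (c < n)%N && (c != i)) (fun c => s c : nat) Pk).
move=> j /andP[jn ji] jmin; exists i, j; split => //.
have lt c d : c != d -> (s c <= s d)%N -> (s c < s d)%N.
  by move=> cd; rewrite leq_eqVlt (inj_eq val_inj) (inj_eq perm_inj) (negbTE cd).
apply/andP; split; first by apply: lt; [rewrite eq_sym | exact: imin].
apply/forallP => c; apply/implyP => /and3P[cn ci cj].
by apply: lt; [rewrite eq_sym | apply: jmin; rewrite cn].
Qed.

Lemma best_two_unique N n (s : 'S_N) (i j i' j' : 'I_N) :
  (i < n)%N -> (j < n)%N -> (i' < n)%N -> (j' < n)%N ->
  best_two n i j s -> best_two n i' j' s -> (i, j) = (i', j').
Proof.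
move=> i_n jn in' jn' /(rel_rank2P s jn i_n)[i1 j2] /(rel_rank2P s jn' in')[i1' j2'].
have inj (x y : 'I_N) (xn : (x < n)%N) (yn : (y < n)%N) :
    rel_rank s n x = rel_rank s n y -> x = y.
  wlog sxy : x y xn yn / (s x <= s y)%N.
    by move=> W; case: (leqP (s x) (s y)) => [|/ltnW] h e; [|apply/esym]; apply: W.
  move=> e; apply: (@perm_inj _ s); apply/val_inj/eqP; rewrite /= eqn_leq sxy /=.
  (* The set counted for [x] lies in the one for [y]; equal cardinalities make them equal, so [y] is
     counted for [x]. *)
  have := rel_rank_self s (yn : (pos y <= n)%N).
  have /eqP <- : [set b : 'I_N | (pos b <= n)%N && (abs_rank s b <= abs_rank s x)%N]
      == [set b : 'I_N | (pos b <= n)%N && (abs_rank s b <= abs_rank s y)%N].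
    rewrite eqEcard -[X in (X <= _)%N]/(rel_rank s n y) -e leqnn andbT.
    apply/fintype.subsetP => b; rewrite !inE /abs_rank !ltnS => /andP[-> /=] h.
    exact: leq_trans sxy.
  by rewrite inE => /andP[].
by congr pair; apply: inj; rewrite // ?i1 ?j2.
Qed.

(* The ordered pairs of distinct indices below n are equally likely to be the
   two best, and exactly one of them is. *)
Lemma card_best_two N n (i j : 'I_N) : (n <= N)%N ->
  (i < n)%N -> (j < n)%N -> i != j ->
  (#|best_two_set n i j| * (n * n.-1) = N`!)%N.
Proof.
move=> nN i_n jn ij.
have n1 : (1 < n)%N by move: ij i_n jn; rewrite -(inj_eq val_inj) /=; lia.
pose D := [set p : 'I_N * 'I_N | [&& (p.1 < n)%N, (p.2 < n)%N & p.1 != p.2]].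
have cD : #|D| = (n * n.-1)%N.
  pose A := [set x : 'I_N | (x < n)%N].
  have cA : #|A| = n by exact: card_ord_ltn.
  rewrite -sum1_card (eq_bigl (fun p : 'I_N * 'I_N => (p.1 \in A) && (p.2 \in A :\ p.1)));
    last by move=> p; rewrite !inE [p.2 == _]eq_sym [(p.1 != _) && _]andbC.
  rewrite -(pair_big_dep (mem A) (fun x y => y \in A :\ x) (fun _ _ => 1%N)) /=.
  rewrite (eq_bigr (fun _ => n.-1)) ?sum_nat_const ?cA // => x xA.
  by rewrite sum1_card -cA (cardsD1 x A) xA.
(* Double counting of the pairs of [p] in [D] and [s] with [best_two n p.1 p.2 s]: summed over [p]
   this is the left side, and each [s] contributes 1. *)
rewrite -(card_Sn N) -cD mulnC -sum_nat_const -[RHS]sum1_card.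
rewrite (eq_bigr (fun p => \sum_(s : 'S_N | best_two n p.1 p.2 s) 1)%N); last first.
  move=> [i' j']; rewrite inE => /and3P[/= i'n j'n ij'].
  by rewrite sum1dep_card; apply: card_best_two_sym.
rewrite (exchange_big_dep predT) //=; apply: eq_big => s.
  by rewrite unfold_in /=.
move=> _; have [i' [j' [i'n j'n st]]] := best_two_exists s (introT andP (conj n1 nN)).
rewrite sum1dep_card; apply/eqP/cards1P; exists (i', j').
apply/setP => -[x y]; rewrite !inE /=.
apply/andP/eqP => [[/and3P[xn yn _] xy]|[-> ->]].
  exact: best_two_unique xy st.
split=> //; rewrite i'n j'n /=; case/andP: st => st _.
by apply: contraTneq st => ->; rewrite ltnn.
Qed.

(** * Windows, conditional probabilities and policies *)

Lemma seenE N K (a : 'I_N) : seen K a = minn (a + K) N.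
Proof. by rewrite /seen /pos addSn subn1. Qed.

Lemma cond_probE N (A B : {set 'S_N}) : cond_prob A B = #|A :&: B|%:R / #|B|%:R.
Proof.
rewrite /cond_prob /prob -mulf_div divff ?mulr1 // invr_neq0 // pnatr_eq0.
by rewrite cardsT card_Sn -lt0n fact_gt0.
Qed.

Lemma play_inv N K (p : policy N) (s : 'S_N) (w : seq 'I_N) b :
  play K p s w = Some b -> exists2 a, a \in w & p (a, observe K s a) = Some b.
Proof.
elim: w => //= a w IH; case E: (p _) => [c|].
  by case=> <-; exists a; rewrite ?mem_head.
by move=> /IH[a' aw pa]; exists a'; rewrite // inE aw orbT.
Qed.

(** The choice is made at some later window start [a'], and admissibility puts [b] at or after
    [a']. *)
Lemma play_after_pos N K (p : policy N) (s : 'S_N) (a b : 'I_N) :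
  admissible K p -> play_after K p s a = Some b -> (a < b)%N.
Proof.
move=> /forallP adm /play_inv[a']; rewrite mem_filter /pos ltnS => /andP[aa' _] E.
have /forallP/(_ (observe K s a')) := adm a'; rewrite E => /andP[ab _].
exact: leq_trans aa' ab.
Qed.

(** Waits until all applicants are seen; relative ranks are then absolute, and any window member of
    rank 1 or 2 is taken. Entry 0 encodes an unseen applicant. *)
Definition patient_policy (N K : nat) : policy N :=
  [ffun x : 'I_N * observations N =>
     if seen K x.1 == N then [pick b | in_window K x.1 b && (0 < x.2 b <= 2)%N]
     else None].

Lemma admissible_patient N K : admissible K (patient_policy N K).
Proof.
apply/forallP => a; apply/forallP => o; rewrite ffunE /=.
by case: eqP => // _; case: pickP => // b /andP[].
Qed.

Lemma patient_policyE N K (s : 'S_N) (a : 'I_N) :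
  patient_policy N K (a, observe K s a) =
  if seen K a == N then [pick b : 'I_N | (a <= b)%N && (s b < 2)%N] else None.
Proof.
rewrite ffunE /=; case: eqP => // aN; apply: eq_pick => b.
rewrite /in_window aN /pos ltn_ord andbT ltnS ffunE aN ltn_ord rel_rank_full.
by rewrite inordK // ltnS.
Qed.

(** Whatever this policy chooses wins, and if nothing was chosen before the window reaches [b], then
    [b] itself is eligible there. *)
Lemma patient_policy_wins N K (s : 'S_N) (a b : 'I_N) :
  (a < b)%N -> (s b < 2)%N -> seen K b = N ->
  win s (play_after K (patient_policy N K) s a).
Proof.
move=> ab sb bN; rewrite /play_after.
have : b \in [seq c <- enum 'I_N | (pos a < pos c)%N].
  by rewrite mem_filter mem_enum andbT.
elim: [seq _ <- _ | _] => //= c w IH; rewrite patient_policyE inE.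
case/orP => [/eqP <-|bw].
  by rewrite bN eqxx; case: pickP => [d /andP[]|/(_ b)] //; rewrite leqnn sb.
by case: ifP => _; [case: pickP => [d /andP[]|_] //|]; exact: IH.
Qed.

(** * The window starting at index 2 *)

Section SecondIndex.

Variables (N K : nat) (a1 a2 : 'I_N).
Hypotheses (KN : (K < N)%N) (K0 : (0 < K)%N).
Hypotheses (a10 : a1 = 0%N :> nat) (a21 : a2 = 1%N :> nat).

Let E := two_candidate_event K a2.
Let W := best_two_set N a1 a2.

(** This window has revealed [K.+1] applicants, and [a1] is the only one before [a2]. *)
Lemma two_candidate_second (s : 'S_N) :
  two_candidate K s a2 = best_two K.+1 a1 a2 s.
Proof.
have a1n : (pos a1 <= K.+1)%N by rewrite /pos a10.
have a2n : (pos a2 <= K.+1)%N by rewrite /pos a21.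
have -> : two_candidate K s a2 =
    (rel_rank s K.+1 a2 == 2)%N && (rel_rank s K.+1 a1 == 1)%N.
  rewrite /two_candidate seenE a21 add1n (minn_idPl KN); congr (_ && _).
  apply/existsP/idP => [[b /andP[ba]]|a1b]; last by exists a1; rewrite /pos a10 a21.
  suff -> : b = a1 by [].
  by apply/val_inj => /=; rewrite /pos a21 in ba; lia.
by apply/andP/(rel_rank2P s a2n a1n) => [[/eqP ? /eqP ?]|[-> ->]].
Qed.

Lemma win_second_candidate : [set s | win s (Some a2)] :&: E = W.
Proof.
apply/setP => s; rewrite !inE two_candidate_second best_two_full.
rewrite /win /abs_rank; apply/andP/andP => [[sa2 /andP[sa12 _]]|[/eqP s1 /eqP s2]].
  by split; lia.
rewrite s2; split=> //; rewrite /best_two s1 s2 /=; apply/forallP => c.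
apply/implyP => /and3P[_ c1 c2].
have: s c != s a1 by rewrite (inj_eq perm_inj).
have: s c != s a2 by rewrite (inj_eq perm_inj).
by rewrite -!(inj_eq val_inj) /= s1 s2; lia.
Qed.

Lemma card_win_second : (#|W| * (N * N.-1) = N`!)%N.
Proof. by apply: card_best_two => //; rewrite -(inj_eq val_inj) /= a10 a21. Qed.

Lemma card_second_candidate : (#|E| * (K.+1 * K) = N`!)%N.
Proof.
rewrite -[RHS](@card_best_two N K.+1 a1 a2) ?a10 ?a21 //; last first.
  by rewrite -(inj_eq val_inj) /= a10 a21.
by congr (#|pred_of_set _| * _)%N; apply/setP => s; rewrite !inE two_candidate_second.
Qed.

Lemma card_second_candidate_gt0 : (0 < #|E|)%N.
Proof. by move: card_second_candidate (fact_gt0 N); case: #|E| => // <-. Qed.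

Lemma choose_value_second : choose_value K a2 = #|W|%:R / #|E|%:R.
Proof. by rewrite /choose_value cond_probE win_second_candidate. Qed.

Lemma subWE : W \subset E.
Proof. by rewrite -win_second_candidate finset.subsetIr. Qed.

Lemma lose_value_second : 1 - choose_value K a2 = #|E :\: W|%:R / #|E|%:R.
Proof.
rewrite choose_value_second -{1}(@divff _ #|E|%:R); last first.
  by rewrite pnatr_eq0 -lt0n card_second_candidate_gt0.
by rewrite -mulrBl cardsDS ?subWE // natrB // subset_leq_card // subWE.
Qed.

Lemma reject_value_second_le : reject_value K a2 <= 1 - choose_value K a2.
Proof.
rewrite lose_value_second; apply: bigmax_le => [|p adm]; first by rewrite divr_ge0 ?ler0n.
rewrite cond_probE ler_pM2r ?invr_gt0 ?ltr0n ?card_second_candidate_gt0 //.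
rewrite ler_nat subset_leq_card //.
apply/fintype.subsetP => s; rewrite inE [s \in E :\: W]inE andbC => /andP[-> /=].
rewrite andbT !inE.
case pE: (play_after _ _ _ _) => [b|//] /=; have := play_after_pos adm pE.
rewrite best_two_full /abs_rank a21 => b1 sb; apply/negP => /andP[/eqP s1 /eqP s2].
(* On [W] both winning ranks are held by [a1] and [a2], but [b] comes after them. *)
have: s b != s a1 by rewrite (inj_eq perm_inj) -(inj_eq val_inj) /= a10; lia.
have: s b != s a2 by rewrite (inj_eq perm_inj) -(inj_eq val_inj) /= a21; lia.
by rewrite -!(inj_eq val_inj) /= s1 s2; lia.
Qed.

Lemma reject_value_second_ge : (N <= 2 * K + 1)%N ->
  1 - choose_value K a2 <= reject_value K a2.
Proof.
move=> NK.
rewrite lose_value_second; apply: le_trans (le_bigmax_cond _ _ (admissible_patient N K)).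
rewrite cond_probE ler_pM2r ?invr_gt0 ?ltr0n ?card_second_candidate_gt0 //.
rewrite ler_nat subset_leq_card //.
apply/fintype.subsetP => s; rewrite inE [s \in _ :&: _]inE andbC => /andP[sE sW].
rewrite sE andbT inE; move: sE sW; rewrite !inE two_candidate_second // best_two_full.
move=> /andP[s12 /forallP sE] sW.
(* The holders of absolute ranks 1 and 2: here [a1] and [a2] serve as the values 0 and 1. If neither
   comes after the first [K.+1] applicants, they are [a1] and [a2], contradicting [sW]. *)
pose b0 := (s^-1 a1)%g; pose b1 := (s^-1 a2)%g.
have sb0 : s b0 = 0%N :> nat by rewrite permKV a10.
have sb1 : s b1 = 1%N :> nat by rewrite permKV a21.
(* From [K < b] and [N <= 2 * K + 1] follows [N <= b + K], so the window starting at [b] has seen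
   everyone. *)
have late b : (s b < 2)%N -> (K < b)%N -> win s (play_after K (patient_policy N K) s a2).
  move=> sb Kb; apply: (@patient_policy_wins _ _ _ _ b) => //; first by rewrite a21; lia.
  by rewrite seenE; apply/minn_idPr; lia.
have [b0K|] := leqP b0 K; last by apply: late; rewrite sb0.
have [b1K|] := leqP b1 K; last by apply: late; rewrite sb1.
have e0 : b0 = a1.
  apply/eqP; apply: contraT => b01.
  have [e|b02] := eqVneq b0 a2; first by move: s12; rewrite -e sb0.
  by have := sE b0; rewrite ltnS b0K b01 b02 sb0.
have e1 : b1 = a2.
  apply/eqP; apply: contraT => b12.
  have b11 : b1 != a1 by apply/eqP => e; move: sb1; rewrite e -e0 sb0.
  have := sE b1; rewrite ltnS b1K b11 b12 sb1 /=.
  by move: s12; lia.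
by move: sW; rewrite -e0 -e1 sb0 sb1.
Qed.

(** Both cardinality formulas equal [N!], so the value is [K (K + 1) / (N (N - 1))]. *)
Lemma choose_second_le_half :
  (choose_value K a2 <= 1 / 2) = (2 * (K * K.+1) <= N * N.-1)%N.
Proof.
have E0 := card_second_candidate_gt0; have N1 : (1 < N)%N by lia.
rewrite choose_value_second ler_pdivrMr ?ltr0n // mulrAC ler_pdivlMr // mul1r.
rewrite -natrM ler_nat.
have := card_second_candidate; rewrite -card_win_second => e.
have W0 : (0 < #|W|)%N by move: e E0 K0; case: #|W| => //; lia.
apply/idP/idP => h.
  by rewrite -(leq_pmul2l W0) -e; nia.
by rewrite -(leq_pmul2r (_ : 0 < K.+1 * K)%N) ?e; nia.
Qed.

Lemma choose_second_le_reject : (2 * (K * K.+1) <= N * N.-1)%N ->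
  (N <= 2 * K + 1)%N -> choose_value K a2 <= reject_value K a2.
Proof.
rewrite -choose_second_le_half => c NK.
by apply: le_trans (reject_value_second_ge NK); lra.
Qed.

Lemma choose_second_le_rejectW : choose_value K a2 <= reject_value K a2 ->
  (2 * (K * K.+1) <= N * N.-1)%N.
Proof.
rewrite -choose_second_le_half => c.
by have := reject_value_second_le; lra.
Qed.

End SecondIndex.

(** * The threshold and the extremal window size *)

(** Keeps the list in [d2_star] nonempty. No window position remains after index [N], while a
    2-candidate there has absolute rank 2. *)
Lemma choose_last N K (a : 'I_N) : (0 < K)%N -> (2 < N)%N -> pos a = N ->
  reject_value K a < choose_value K a.
Proof.
move=> K0 N2 aN; have seenN : seen K a = N.
  by rewrite seenE; apply/minn_idPr; rewrite -[X in (X <= _)%N]aN /pos; lia.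
have -> : reject_value K a = 0.
  apply: big1_idem => [|p _]; first exact: maxxx.
  rewrite cond_probE (_ : _ :&: _ = finset.set0) ?cards0 ?mul0r //.
  apply/setP => s; rewrite !inE /play_after (eq_filter (a2 := pred0)) ?filter_pred0 //.
  by move=> b /=; rewrite aN ltnNge; apply/negbF; exact: ltn_ord.
suff E0 : (0 < #|two_candidate_event K a|)%N.
  rewrite /choose_value cond_probE (_ : _ :&: _ = two_candidate_event K a).
    by rewrite divff // pnatr_eq0 -lt0n.
  apply/finset.setIidPr/fintype.subsetP => s.
  rewrite !inE /two_candidate seenN rel_rank_full.
  by case/andP => /eqP sa _; rewrite /win /abs_rank sa.
pose o0 := Ordinal (ltnW (ltnW N2)); pose o1 := Ordinal (ltnW N2).
have oa : a != o0 /\ o1 != o0.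
  by split; rewrite -(inj_eq val_inj) /= -?lt0n //; move: aN; rewrite /pos; lia.
(* This permutation gives [a] rank 2 and leaves rank 1 to the first applicant. *)
apply/card_gt0P; exists (tperm a o1).
rewrite inE /two_candidate seenN rel_rank_full tpermL /=.
apply/existsP; exists o0; rewrite rel_rank_full tpermD //; try by case: oa.
by rewrite andbT /pos ltnS lt0n; case: oa.
Qed.

(** The list is nonempty and increasing with entries at least 2, so its head minus 1 exceeds 1 iff 2
    is not in it. *)
Lemma d2_star_gt1 N K (a2 : 'I_N) : (0 < K)%N -> (2 < N)%N -> a2 = 1%N :> nat ->
  (1 < d2_star N K)%N = (choose_value K a2 <= reject_value K a2).
Proof.
move=> K0 N2 a21; rewrite leNgt /d2_star.
pose P (a : 'I_N) := (2 <= pos a)%N && (reject_value K a < choose_value K a).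
have N1 : (N.-1 < N)%N by lia.
have Pl : P (Ordinal N1).
  by rewrite /P /pos /= choose_last // ?andbT /pos /=; lia.
have Pa2 : P a2 = (reject_value K a2 < choose_value K a2) by rewrite /P /pos a21.
rewrite -Pa2.
have srt : sorted ltn [seq pos a | a <- enum 'I_N & P a].
  rewrite sorted_map; apply: sorted_filter => [y x z|]; first exact: ltn_trans.
  rewrite -(@eq_sorted _ (relpre val ltn)) => [|x y /=]; last by rewrite ltnS.
  by rewrite -sorted_map val_enum_ord iota_ltn_sorted.
have mem2 : P a2 = (2%N \in [seq pos a | a <- enum 'I_N & P a]).
  apply/idP/mapP => [h|[b]].
    by exists a2; [rewrite mem_filter h mem_enum | rewrite /pos a21].
  rewrite mem_filter /pos => /andP[Pb _] [b1].
  by rewrite (_ : a2 = b) //; apply/val_inj; rewrite /= a21.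
have meml : N \in [seq pos a | a <- enum 'I_N & P a].
  by apply/mapP; exists (Ordinal N1); [rewrite mem_filter Pl mem_enum
   | rewrite /pos /=; lia].
have ge2 x : x \in [seq pos a | a <- enum 'I_N & P a] -> (2 <= x)%N.
  by case/mapP => b; rewrite mem_filter => /andP[/andP[? _] _] ->.
rewrite mem2; case: [seq pos a | a <- _] srt meml ge2 => //= x t srt _ ge2.
rewrite inE negb_or; have x2 := ge2 _ (mem_head x t).
have [x3|x3] := eqVneq 2%N x; first by rewrite -x3.
rewrite (_ : (1 < x.-1)%N); last by lia.
apply/esym/negP => t2.
have /allP/(_ _ t2) := order_path_min ltn_trans srt.
by rewrite /=; lia.
Qed.

(** The bound holds for the default 0, for each eligible [K], and passes to maxima. *)
Lemma K_max_upper N : (2 < N)%N -> (2 * (K_max N * (K_max N).+1) <= N * N.-1)%N.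
Proof.
move=> N2; rewrite /K_max; apply: (big_ind (fun m => 2 * (m * m.+1) <= N * N.-1)%N).
- by rewrite mul0n muln0.
- by move=> m n mN nN; case: (leqP m n).
move=> K /andP[K0]; have N1 : (0 < N)%N by lia.
rewrite (@d2_star_gt1 _ _ (Ordinal (ltnW N2))) //.
exact: (@choose_second_le_rejectW _ _ (Ordinal N1) _ (ltn_ord K)).
Qed.

Lemma K_max_lower N : (3 < N)%N -> (N * N.-1 < 2 * ((K_max N).+1 * (K_max N).+2))%N.
Proof.
move=> N3; pose P K := (2 * (K * K.+1) <= N * N.-1)%N.
have exP : exists K, P K by exists 0%N; rewrite /P mul0n muln0.
have ubP K : P K -> (K <= N)%N by rewrite /P; nia.
case: (ex_maxnP exP ubP) => K PK Kmax; rewrite /P in PK.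
have {}Kmax : (N * N.-1 < 2 * (K.+1 * K.+2))%N.
  by rewrite ltnNge; apply/negP => /Kmax; rewrite ltnn.
(* Otherwise [(2 K + 2) (2 K + 1) < 2 (K + 1) (K + 2)], which forces [K = 0] and then
   [N (N - 1) < 4]. *)
have NK : (N <= 2 * K + 1)%N by nia.
have KN : (K < N)%N by nia.
have K0 : (0 < K)%N by lia.
suff : (K <= K_max N)%N by nia.
have N1 : (0 < N)%N by lia.
have N2 : (1 < N)%N by lia.
apply: (@leq_bigmax_cond _ _ (fun K : 'I_N => K : nat) (Ordinal KN)).
rewrite /= K0 (@d2_star_gt1 _ _ (Ordinal N2)) ?(ltnW N3) //.
exact: (@choose_second_le_reject _ _ (Ordinal N1)).
Qed.

(** * Asymptotics of the ratio *)

Lemma K_max_ratio_dist (R : realType) (N : nat) : (3 < N)%N ->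
  `|1 - (K_max N)%:R / ((N%:R - 1) / Num.sqrt 2)| <= 3 / (N%:R - 1) :> R.
Proof.
move=> N3; have := K_max_upper (ltnW N3); have := K_max_lower N3.
rewrite -(ltr_nat R) -(ler_nat R) !natrM.
have -> : N%:R = N.-1%:R + 1 :> R by rewrite natr1 prednK //; lia.
set k := K_max N; rewrite addrK -[k.+2%:R]natr1 -[k.+1%:R]natr1.
have m3 : (3 <= N.-1)%N by lia.
have m0 : 3 <= N.-1%:R :> R by rewrite ler_nat.
have k0 : 0 <= k%:R :> R by rewrite ler0n.
have s2 : Num.sqrt 2 * Num.sqrt 2 = 2 :> R by rewrite -expr2 sqr_sqrtr.
move: m0 k0 s2 (sqrtr_ge0 (2 : R)).
move: (N.-1%:R) (k%:R) (Num.sqrt 2) => x y s x3 y0 s2 s0 lo up.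
(* With [x = N - 1], [y = K_max N] and [s] the root of 2, the aim is [-1 <= x - y s <= 2 s <= 3]. *)
have sn : 1 <= s <= 3 / 2 by apply/andP; split; nra.
have -> : 1 - y / (x / s) = (x - y * s) / x.
  by rewrite invf_div mulrA mulrBl divff //; lra.
rewrite normrM (@ger0_norm _ x^-1) ?invr_ge0; last by lra.
rewrite ler_pM2r ?invr_gt0; last by lra.
(* Squared: [2 y^2 <= 2 y (y + 1) <= x (x + 1) <= (x + 1)^2]; next, [x^2 <= x (x + 1) < 2 (y + 1) (y
   + 2) <= 2 (y + 2)^2]. *)
have : y * s <= x + 1 by rewrite -ler_sqr ?nnegrE; nra.
have : x <= (y + 2) * s by rewrite -ler_sqr ?nnegrE; nra.
by rewrite ler_norml => *; apply/andP; split; nra.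
Qed.

Local Open Scope classical_set_scope.

Theorem theorem4p4 (R : realType) :
  (fun N : nat => (K_max N)%:R / ((N%:R - 1) / Num.sqrt 2) : R) @ \oo --> (1 : R).
Proof.
apply/cvgrPdist_le => e e0; near=> N.
have N3 : (3 < N)%N by near: N; exact: nbhs_infty_gt.
apply: le_trans (K_max_ratio_dist R N3) _.
have N1 : 0 < N%:R - 1 :> R by rewrite subr_gt0 ltr1n; lia.
(* The error bound is at most [e] as soon as [3 / e + 1 <= N]. *)
rewrite ler_pdivrMr // mulrC -ler_pdivrMr // lerBrDr.
near: N; exact: nbhs_infty_ger.
Unshelve. all: by end_near.
Qed.
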